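(* Let $m,k\ge 1$ be integers, let $H$ be a graph with vertex set $\{v_1,\dots,v_k\}$, let $\mathcal F=\{G_1,\dots,G_k\}$ be a family of graphs with $V(G_i)=\{v_i^1,\dots,v_i^{n_i}\}$, and let $\mathcal I=\{I_1,\dots,I_k\}$ be indexing maps $I_i:V(G_i)\to[m]$ with associated indexing matrices $E_1,\dots,E_k$. Let $G$ be the $H_m$-join of $\mathcal F$ with respect to $\mathcal I$, and let $n=\sum_{i=1}^k n_i$. For $1\le i,j\le k$ let $\rho_{i,j}=1$ if $v_iv_j\in E(H)$ and $\rho_{i,j}=0$ otherwise. For $1\le i\le k$ let $\phi_i=\det(\lambda I_{n_i}-A(G_i))$ and $\Gamma_i=E_i^t(\lambda I_{n_i}-A(G_i))^{-1}E_i$. Then $$\det(\lambda I_n-A(G))=\Bigl(\prod_{i=1}^k\phi_i\Bigr)\det(\widetilde A),$$ where $\widetilde A$ is the $km\times km$ block matrix $$\widetilde A=\begin{bmatrix} I_m & -\rho_{1,2}\Gamma_1&\cdots&-\rho_{1,k}\Gamma_1\\ -\rho_{2,1}\Gamma_2& I_m&\cdots&-\rho_{2,k}\Gamma_2\\ \vdots&\vdots&\ddots&\vdots\\ -\rho_{k,1}\Gamma_k&-\rho_{k,2}\Gamma_k&\cdots&I_m\end{bmatrix}.$$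
   Context: All graphs are finite and simple. $A(G)$ denotes the adjacency matrix of $G$, $I_n$ the identity matrix of order $n$, and $[m]=\{1,\dots,m\}$. The variable $\lambda$ is an indeterminate; matrices such as $(\lambda I_{n_i}-A(G_i))^{-1}$ have entries in $\mathbb C(\lambda)$. $H_m$-join: given $H$ on $\{v_1,\dots,v_k\}$, graphs $G_1,\dots,G_k$ and maps $I_i:V(G_i)\to[m]$ (indexing maps), the $H_m$-join is the graph with vertex set $\bigsqcup_{i=1}^k V(G_i)$ whose edges are all edges of all the $G_i$, together with all pairs $uv$ such that $u\in V(G_i)$, $v\in V(G_j)$, $v_iv_j\in E(H)$ and $I_i(u)=I_j(v)$. Indexing matrix: $E_i$ is the $n_i\times m$ matrix with $(E_i)_{st}=1$ if $I_i(v_i^s)=t$ and $0$ otherwise. *)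

(* Defs.v *)
From mathcomp Require Import all_boot all_order all_algebra.
From mathcomp Require Import complex.
From mathcomp Require Import reals.

Set Implicit Arguments.
Unset Strict Implicit.
Unset Printing Implicit Defensive.

Import GRing.Theory.
Local Open Scope ring_scope.

Record sgraph (T : finType) := SGraph {
  adj :> rel T;
  adj_sym : symmetric adj;
  adj_irr : irreflexive adj
}.

(* C(lambda): C is R[i], with R : realType, and lambda is the polynomial variable. *)
Definition ratfun (R : realType) := {fraction {poly R[i]}}.
Definition lam (R : realType) : ratfun R := FracField.tofrac 'X.

Section LabelledMatrices.
Variables (K : fieldType) (T : finType) (n : nat) (v : 'I_n -> T).

(* [v] lists the vertices; it is meant to be bijective. *)
Definition adjmx (G : sgraph T) : 'M[K]_n :=
  \matrix_(s, t) (G (v s) (v t))%:R.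

Definition indexmx (m : nat) (I : T -> 'I_m) : 'M[K]_(n, m) :=
  \matrix_(s, t) (I (v s) == t)%:R.

End LabelledMatrices.

Section Join.
Variables (m k : nat) (H : sgraph 'I_k) (V : 'I_k -> finType).
Variables (G : forall i, sgraph (V i)) (I : forall i, V i -> 'I_m).

(* The disjoint union of the V i is the sigma type; [tagged_as x y] is the
   second component of y transported to the fibre of x when the tags agree. *)
Definition Hmjoin_adj : rel {i : 'I_k & V i} := fun x y =>
  ((tag x == tag y) && G (tag x) (tagged x) (tagged_as x y))
  || (H (tag x) (tag y) && (I (tagged x) == I (tagged y))).

Lemma Hmjoin_sym : symmetric Hmjoin_adj.
Proof.
move=> [i a] [j b]; rewrite /Hmjoin_adj /= (adj_sym H) (eq_sym (I a)).
congr (_ || _); rewrite (eq_sym j); case: (eqVneq i j) => //= eij.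
by subst j; rewrite !tagged_asE /= adj_sym.
Qed.

Lemma Hmjoin_irr : irreflexive Hmjoin_adj.
Proof.
by move=> [i a]; rewrite /Hmjoin_adj /= tagged_asE !adj_irr andbF.
Qed.

Definition Hmjoin : sgraph {i : 'I_k & V i} := SGraph Hmjoin_sym Hmjoin_irr.

End Join.

Section JoinBlock.
Variables (K : fieldType) (m k : nat) (H : sgraph 'I_k).

Definition rho (i j : 'I_k) : K := (H i j)%:R.

(* The order of this matrix is the iterated sum \sum_(i < k) m = k * m. *)
Definition join_block_mx (Gam : 'I_k -> 'M[K]_m) : 'M[K]_(\sum_(i < k) m) :=
  \mxblock_(i < k, j < k) (if i == j then 1%:M else - (rho i j *: Gam i)).

End JoinBlock.

(* Main.v *)
Require Import Defs.
From mathcomp Require Import all_boot all_order all_fingroup all_algebra.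
From mathcomp Require Import complex.
From mathcomp Require Import reals.

(* Order the vertices of the join block by block. Then lambda I - A(G) = D - F C,
   where D is the block diagonal matrix of the lambda I - A(G_i), F has blocks
   rho_(i,j) E_i and C is the block diagonal matrix of the E_i^t. Since
   det(I - X Y) = det(I - Y X), the determinant is det D * det(I - C D^-1 F),
   and the blocks of C D^-1 F are the rho_(i,j) Gamma_i. *)

Set Implicit Arguments.
Unset Strict Implicit.
Unset Printing Implicit Defensive.

Import GRing.Theory.
Local Open Scope ring_scope.

Lemma det_castmx (R : comNzRingType) (m n : nat) (e : m = n) (A : 'M[R]_m) :
  \det (castmx (e, e) A) = \det A.
Proof. by case: n / e. Qed.

Lemma det_mxdiag (R : comNzRingType) (p : nat) (p_ : 'I_p -> nat)
    (B : forall i, 'M[R]_(p_ i)) :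
  \det (\mxdiag_i B i) = \prod_i \det (B i).
Proof.
elim: p => [|p IHp] in p_ B *.
  rewrite [RHS]big_ord0 -[RHS](det1 R (\sum_(i < 0) p_ i)); congr (\det _).
  (* An index [s] would have its block number in ['I_0], so both matrices are empty. *)
  by apply/matrixP=> s; have := tagnat.sig s => -[[]].
by rewrite mxdiag_recl det_castmx det_ublock IHp big_ord_recl.
Qed.

(** The sign of [s] enters once from the rows and once from the columns, and its square is 1. *)
Lemma det_mxsub_perm (R : comNzRingType) (n : nat) (s : 'S_n) (A : 'M[R]_n) :
  \det (mxsub s s A) = \det A.
Proof.
have -> : mxsub s s A = row_perm s (col_perm s A).
  by apply/matrixP=> i j; rewrite !mxE.
rewrite row_permE col_permE !det_mulmx !det_perm odd_permV.
by rewrite mulrCA -expr2 sqrr_sign mulr1.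
Qed.

(** Multiplying the block matrix [M] by one unitriangular matrix, on the left or on the right,
    clears its lower left block and leaves [1 - B A] or [1 - A B] as the only nontrivial diagonal
    block. Both products have determinant [\det M]. *)
Lemma det_1_sub_mulC (R : comNzRingType) (m n : nat)
    (A : 'M[R]_(m, n)) (B : 'M[R]_(n, m)) :
  \det (1%:M - A *m B) = \det (1%:M - B *m A).
Proof.
pose M := block_mx 1%:M A B 1%:M.
have detMl : \det (block_mx 1%:M 0 (- B) 1%:M *m M) = \det (1%:M - B *m A).
  rewrite mulmx_block !mul1mx !mul0mx !addr0 mulmx1 addNr det_ublock det1 mul1r.
  by rewrite mulNmx addrC.
have detMr : \det (M *m block_mx 1%:M 0 (- B) 1%:M) = \det (1%:M - A *m B).
  rewrite mulmx_block !mulmx1 !mulmx0 !mul1mx subrr add0r add0r det_ublock det1.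
  by rewrite mulr1 mulmxN.
by rewrite -detMl -detMr !det_mulmx mulrC.
Qed.

(** Two enumerations of the vertices differ by a permutation, and conjugation by it fixes scalar
    matrices. *)
Lemma det_sub_adjmx_relabel (K : fieldType) (T : finType) (n : nat)
    (G : sgraph T) (v w : 'I_n -> T) (x : K) : bijective v -> bijective w ->
  \det (x%:M - adjmx K w G) = \det (x%:M - adjmx K v G).
Proof.
move=> [v' vK v'K] w_bij.
have inj_s : injective (v' \o w) by apply: inj_comp (can_inj v'K) (bij_inj w_bij).
rewrite -(det_mxsub_perm (perm inj_s) (_ - adjmx K v G)); congr (\det _).
by apply/matrixP=> i j; rewrite !mxE (inj_eq perm_inj) !permE /= !v'K.
Qed.

(** Each vertex has exactly one label, so only the term at [I (v s)] can survive. These products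
    give the edges between different blocks of the join. *)
Lemma indexmx_mul_tr (K : fieldType) (m n p : nat) (T U : finType)
    (v : 'I_n -> T) (u : 'I_p -> U) (I : T -> 'I_m) (J : U -> 'I_m) s t :
  (indexmx K v I *m (indexmx K u J)^T) s t = (I (v s) == J (u t))%:R.
Proof.
rewrite mxE (bigD1 (I (v s))) //= !mxE eqxx mul1r big1 ?addr0; last first.
  by move=> j; rewrite !mxE eq_sym => /negPf ->; rewrite mul0r.
by rewrite eq_sym.
Qed.

Section Join.
Variables (K : fieldType) (m k : nat) (H : sgraph 'I_k) (V : 'I_k -> finType).
Variables (G : forall i, sgraph (V i)) (n : 'I_k -> nat).
Variables (v : forall i, 'I_(n i) -> V i) (I : forall i, V i -> 'I_m).

(** This enumeration matches the indexing of [\mxblock]: [tagnat.sig] splits an index into a block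
    number and a position in that block. *)
Definition join_label (s : 'I_(\sum_(i < k) n i)) : {i : 'I_k & V i} :=
  let x := tagnat.sig s in Tagged V (v (tagged x)).

Lemma join_label_bij : (forall i, bijective (@v i)) -> bijective join_label.
Proof.
move=> v_bij.
(* Bijectivity only asserts that an inverse exists for each [i]; [xchoose] selects a whole family of
   inverses. *)
have surj (i : 'I_k) (x : V i) : exists a, v a == x.
  by have [v' _ v'K] := v_bij i; exists (v' x); rewrite v'K.
pose v' i x := xchoose (@surj i x).
have v'K i : cancel (v' i) (@v i) by move=> x; apply/eqP/(xchooseP (surj i x)).
have vK i : cancel (@v i) (v' i).
  by move=> a; apply: (bij_inj (v_bij i)); rewrite v'K.
exists (fun x => tagnat.rank (Tagged (fun i => 'I_(n i)) (v' _ (tagged x)))).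
  by move=> s; rewrite /= vK -[RHS]tagnat.sigK; congr (tagnat.rank _); exact: taggedK.
by case=> i x; rewrite /join_label tagnat.rankK /= v'K.
Qed.

Let E i : 'M[K]_(n i, m) := indexmx K (@v i) (@I i).

Lemma adjmx_Hmjoin :
  adjmx K join_label (Hmjoin H G I) =
    \mxdiag_i adjmx K (@v i) (G i)
    + \mxblock_(i < k, j < k) (rho K H i j *: (E i *m (E j)^T)).
Proof.
apply/matrixP=> s t.
rewrite mxE [RHS]mxE [X in _ = X + _]mxE [X in _ = _ + X]mxE.
rewrite /join_label /= /Hmjoin_adj /tagnat.sig1 /tagnat.sig2.
case: (tagnat.sig s) (tagnat.sig t) => [i a] [j b] /=.
rewrite mxE indexmx_mul_tr /rho.
(* Off the diagonal blocks only [H] contributes; on them its term vanishes, as [H] has no loops. *)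
case: eqVneq => [eij | nij] /=; last first.
  by rewrite mxE add0r -natrM mulnb.
case: j / eij in b *.
by rewrite tagged_asE conform_mx_id mxE adj_irr /= orbF mul0r addr0.
Qed.

Lemma det_sub_adjmx_Hmjoin (x : K) :
  (forall i, x%:M - adjmx K (@v i) (G i) \in unitmx) ->
  \det (x%:M - adjmx K join_label (Hmjoin H G I)) =
    (\prod_(i < k) \det (x%:M - adjmx K (@v i) (G i)))
    * \det (join_block_mx H (fun i =>
        (E i)^T *m invmx (x%:M - adjmx K (@v i) (G i)) *m E i)).
Proof.
set D := fun i => x%:M - adjmx K (@v i) (G i) => D_unit.
pose F : 'M[K]_(_, \sum_(j < k) m) :=
  \mxblock_(i < k, j < k) (rho K H i j *: E i).
pose C : 'M[K]_(\sum_(i < k) m, _) :=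
  \mxblock_(i < k, j < k) (if i == j then (E j)^T else 0).
(* [X] is [D^-1 F], with the inverse taken block by block. *)
pose X : 'M[K]_(_, \sum_(j < k) m) :=
  \mxblock_(i < k, j < k) (invmx (D i) *m (rho K H i j *: E i)).
have DX : \mxdiag_i D i *m X = F.
  by rewrite mul_mxdiag_mxblock; apply: eq_mxblock => i j; rewrite mulKVmx //; apply: D_unit.
have FC : F *m C = \mxblock_(i < k, j < k) (rho K H i j *: (E i *m (E j)^T)).
  rewrite mul_mxblock; apply: eq_mxblock => i j; rewrite (bigD1 j) //= eqxx.
  rewrite big1 ?addr0 -?scalemxAl //.
  by move=> l /negPf ->; rewrite mulmx0.
have CX : 1%:M - C *m X = join_block_mx H (fun i => (E i)^T *m invmx (D i) *m E i).
  rewrite mul_mxblock -[1%:M]mxdiagZ /mxdiag -mxblockB.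
  apply: eq_mxblock => i j; rewrite (bigD1 i) //= eqxx big1 => [|l]; last first.
    by rewrite eq_sym => /negPf ->; rewrite mul0mx.
  rewrite addr0 -!scalemxAr mulmxA conform_mx_id /rho.
  (* The diagonal blocks are identities because [H i i] is false. *)
  by case: eqP => [->|_]; rewrite ?adj_irr ?scale0r ?subr0 ?sub0r.
have -> : x%:M - adjmx K join_label (Hmjoin H G I) = \mxdiag_i D i *m (1%:M - X *m C).
  by rewrite mulmxBr mulmx1 mulmxA DX FC adjmx_Hmjoin opprD addrA -mxdiagZ -mxdiagB.
by rewrite det_mulmx det_mxdiag det_1_sub_mulC CX.
Qed.

End Join.

(** The determinant is the image of a characteristic polynomial, which is monic and hence nonzero,
    under the embedding of polynomials into fractions. *)
Lemma lam_sub_adjmx_unit (R : realType) (T : finType) (n : nat) (v : 'I_n -> T)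
    (G : sgraph T) : (lam R)%:M - adjmx (ratfun R) v G \in unitmx.
Proof.
have -> : (lam R)%:M - adjmx (ratfun R) v G =
    map_mx (@FracField.tofrac _) (char_poly_mx (adjmx R[i] v G)).
  apply/matrixP=> i j.
  by rewrite !mxE rmorphB rmorphMn /= polyC_natr rmorph_nat.
rewrite unitmxE det_map_mx unitfE tofrac_eq0.
exact: monic_neq0 (char_poly_monic _).
Qed.

Theorem theorem2 (R : realType) (m k : nat) (hm : (1 <= m)%N) (hk : (1 <= k)%N)
    (H : sgraph 'I_k)
    (V : 'I_k -> finType) (G : forall i : 'I_k, sgraph (V i))
    (n : 'I_k -> nat) (v : forall i : 'I_k, 'I_(n i) -> V i)
    (hv : forall i : 'I_k, bijective (v i))
    (I : forall i : 'I_k, V i -> 'I_m)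
    (w : 'I_(\sum_(i < k) n i) -> {i : 'I_k & V i}) (hw : bijective w) :
  let K := ratfun R in
  let E (i : 'I_k) : 'M[K]_(n i, m) := indexmx K (v i) (I i) in
  let phi (i : 'I_k) : K := \det ((lam R)%:M - adjmx K (v i) (G i)) in
  let Gam (i : 'I_k) : 'M[K]_m :=
    (E i)^T *m invmx ((lam R)%:M - adjmx K (v i) (G i)) *m E i in
  \det ((lam R)%:M - adjmx K w (Hmjoin H G I))
    = (\prod_(i < k) phi i) * \det (join_block_mx H Gam).
Proof.
move=> K E phi Gam.
(* The arbitrary enumeration [w] is exchanged for the blockwise one. *)
rewrite (det_sub_adjmx_relabel _ _ (join_label_bij hv) hw).
by apply: det_sub_adjmx_Hmjoin => i; apply: lam_sub_adjmx_unit.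
Qed.
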